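(* Let $\mathbb{K}$ be a field with a (Krull) valuation $\mathrm{val}:\mathbb{K}\to\Gamma\cup\{\infty\}$ onto a totally ordered abelian group $\Gamma$ together with $\infty$, and let $N\ge1$. The hypersurface associated to the tropicalization of a finite product of non-zero Laurent polynomials in $\mathbb{K}[x_1,x_1^{-1},\ldots,x_N,x_N^{-1}]$ is equal to the union of the hypersurfaces associated to the tropicalizations of the factors. That is, for all non-zero $f,g\in\mathbb{K}[x_1^{\pm1},\ldots,x_N^{\pm1}]$, $$\mathcal{V}(\mathcal{T}(fg))=\mathcal{V}(\mathcal{T}f)\cup\mathcal{V}(\mathcal{T}g),$$ and more generally $\mathcal{V}(\mathcal{T}(f_1\cdots f_k))=\bigcup_{i=1}^k\mathcal{V}(\mathcal{T}f_i)$ for non-zero Laurent polynomials $f_1,\ldots,f_k$, $k\ge1$.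
   Context: A totally ordered group is an abelian group $(\Gamma,+)$ with a total order such that $x\le y$ implies $x+z\le y+z$. Its min-plus algebra is $\mathbb{G}=\Gamma\cup\{\infty\}$ with $a\oplus b=\min\{a,b\}$, $a\odot b=a+b$, $a\oplus\infty=a$, $a\odot\infty=\infty$ (with $\infty$ larger than every element of $\Gamma$). A valuation on a field $\mathbb{K}$ with group of values $\Gamma$ is a surjective map $\mathrm{val}:\mathbb{K}\to\Gamma\cup\{\infty\}$ such that $\mathrm{val}(x)=\infty\iff x=0$, $\mathrm{val}(xy)=\mathrm{val}(x)+\mathrm{val}(y)$, and $\mathrm{val}(x+y)\ge\min\{\mathrm{val}(x),\mathrm{val}(y)\}$. A non-zero Laurent polynomial is written $f=\sum_{\alpha\in\mathcal{E}(f)}\varphi_\alpha x^\alpha$ with $\mathcal{E}(f)\subset\mathbb{Z}^N$ finite and non-empty and all $\varphi_\alpha\in\mathbb{K}\setminus\{0\}$. Its tropicalization is the tropical polynomial $\mathcal{T}f=\bigoplus_{\alpha\in\mathcal{E}(f)}\mathrm{val}(\varphi_\alpha)\odot x^\alpha$, inducing the map $\Gamma^N\to\Gamma$, $\gamma\mapsto\min_{\alpha\in\mathcal{E}(f)}\left(\mathrm{val}(\varphi_\alpha)+\alpha_1\gamma_1+\cdots+\alpha_N\gamma_N\right)$. For $\gamma\in\Gamma^N$, let $\mathcal{D}_\gamma(\mathcal{T}f)$ be the set of $\alpha\in\mathcal{E}(f)$ at which this minimum is attained. The hypersurface associated to $\mathcal{T}f$ is $\mathcal{V}(\mathcal{T}f)=\{\gamma\in\Gamma^N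 : \#\mathcal{D}_\gamma(\mathcal{T}f)>1\}$. *)

(* Defs.v *)
From HB Require Import structures.
From mathcomp Require Import all_boot all_order all_algebra.
From mathcomp Require Import finmap.
From mathcomp Require Import mathcomp_extra boolp classical_sets.
From mathcomp.multinomials Require Import monalg.

Set Implicit Arguments.
Unset Strict Implicit.
Unset Printing Implicit Defensive.

Import Order.TTheory GRing.Theory Num.Theory.

Local Open Scope fset_scope.
Local Open Scope ring_scope.

(* {malg R['rV[int]_N]} has no ring structure in the library, whose monomials
   must form a monoid without non-trivial units; hence the alias, equipped with
   the convolution product. *)
Definition laurent (R : comNzRingType) (N : nat) := {malg R['rV[int]_N]}.

Section LaurentRing.
Variables (R : comNzRingType) (N : nat).
Implicit Types (f g h : laurent R N) (a b : 'rV[int]_N).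

HB.instance Definition _ := GRing.Zmodule.on (laurent R N).

Definition laurent_one : laurent R N := << 1 *g (0 : 'rV[int]_N) >>.

Definition laurent_mul f g : laurent R N :=
  \sum_(a <- msupp f) \sum_(b <- msupp g) << f@_a * g@_b *g (a + b) >>.

Lemma laurent_mulw (E F : {fset 'rV[int]_N}) f g :
    msupp f `<=` E -> msupp g `<=` F ->
  laurent_mul f g =
  \sum_(a <- E) \sum_(b <- F) << f@_a * g@_b *g (a + b) >>.
Proof.
move=> fE gF; rewrite /laurent_mul (big_fset_incl _ fE) /=; last first.
  by move=> a _ /mcoeff_outdom fa; rewrite big1 // => b _; rewrite fa mul0r monalgU0.
apply: eq_bigr => a _; apply: big_fset_incl => // b _ /mcoeff_outdom ->.
by rewrite mulr0 monalgU0.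
Qed.

Lemma laurent_mulC : commutative laurent_mul.
Proof.
move=> f g; rewrite /laurent_mul exchange_big; apply: eq_bigr => b _.
by apply: eq_bigr => a _; rewrite mulrC addrC.
Qed.

Lemma laurent_mulDl : left_distributive laurent_mul +%R.
Proof.
move=> f g h; have hh := fsubset_refl (msupp h).
rewrite (laurent_mulw (msuppD_le f g) hh).
rewrite (laurent_mulw (fsubsetUl (msupp f) (msupp g)) hh).
rewrite (laurent_mulw (fsubsetUr (msupp f) (msupp g)) hh) -big_split /=.
apply: eq_bigr => a _; rewrite -big_split; apply: eq_bigr => b _ /=.
by rewrite mcoeffD mulrDl monalgUD.
Qed.

Lemma laurent_mulDr : right_distributive laurent_mul +%R.
Proof. by move=> f g h; rewrite !(laurent_mulC f) laurent_mulDl. Qed.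

Lemma laurent_mul0l : left_zero 0 laurent_mul.
Proof. by move=> f; rewrite /laurent_mul msupp0 big_seq_fset0. Qed.

Lemma laurent_mul0r : right_zero 0 laurent_mul.
Proof. by move=> f; rewrite laurent_mulC laurent_mul0l. Qed.

Lemma laurent_mulUU (x y : R) a b :
  laurent_mul << x *g a >> << y *g b >> = << x * y *g (a + b) >>.
Proof. by rewrite (laurent_mulw msuppU_le msuppU_le) !big_seq_fset1 !mcoeffUU. Qed.

Lemma laurent_suml (I : Type) (r : seq I) (F : I -> laurent R N) g :
  laurent_mul (\sum_(i <- r) F i) g = \sum_(i <- r) laurent_mul (F i) g.
Proof.
exact: (big_morph (laurent_mul^~ g) (fun _ _ => laurent_mulDl _ _ _)
  (laurent_mul0l g)).
Qed.

Lemma laurent_sumr (I : Type) (r : seq I) (F : I -> laurent R N) g :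
  laurent_mul g (\sum_(i <- r) F i) = \sum_(i <- r) laurent_mul g (F i).
Proof. by rewrite laurent_mulC laurent_suml; apply: eq_bigr => i _; rewrite laurent_mulC. Qed.

Lemma laurent_mul1 : left_id laurent_one laurent_mul.
Proof.
move=> f; rewrite (laurent_mulw msuppU_le (fsubset_refl _)) big_seq_fset1.
rewrite [RHS]monalgE; apply: eq_bigr => b _.
by rewrite mcoeffUU mul1r add0r.
Qed.

Lemma laurent_mulA : associative laurent_mul.
Proof.
move=> f g h; rewrite [f]monalgE (laurent_suml _ _ (laurent_mul g h)).
rewrite (laurent_suml _ _ g) (laurent_suml _ _ h); apply: eq_bigr => a _.
rewrite [g]monalgE (laurent_suml _ _ h) !laurent_sumr (laurent_suml _ _ h).
apply: eq_bigr => b _; rewrite [h]monalgE.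
rewrite (laurent_sumr _ _ << g@_b *g b >>) (laurent_sumr _ _ << f@_a *g a >>).
rewrite (laurent_sumr _ _ (laurent_mul _ _)); apply: eq_bigr => c _.
by rewrite !laurent_mulUU mulrA addrA.
Qed.

Lemma laurent_one_neq0 : laurent_one != 0.
Proof. by rewrite /laurent_one monalgU_eq0 oner_eq0. Qed.

HB.instance Definition _ := GRing.Zmodule_isComNzRing.Build (laurent R N)
  laurent_mulA laurent_mulC laurent_mul1 laurent_mulDl laurent_one_neq0.

End LaurentRing.

(* [porderZmodType] is only the join of zmodType and porderType: it relates
   neither the order to the addition nor any two elements to each other. *)
Record totally_ordered_group (Gamma : porderZmodType) : Prop := {
  tog_total : total (<=%R : rel Gamma);
  tog_leD2r : forall x y z : Gamma, x <= y -> x + z <= y + z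
}.

Section MinPlus.
Variable Gamma : porderZmodType.

(* [None] is the element at infinity. *)
Definition minplus := option Gamma.

Definition mp_le (a b : minplus) : bool :=
  match a, b with
  | _, None => true
  | None, Some _ => false
  | Some x, Some y => x <= y
  end.

Definition mp_add (a b : minplus) : minplus :=
  match a, b with
  | a, None => a
  | None, b => b
  | Some x, Some y => Some (Order.min x y)
  end.

Definition mp_mul (a b : minplus) : minplus :=
  match a, b with
  | Some x, Some y => Some (x + y)
  | _, _ => None
  end.

Record is_valuation (K : fieldType) (val : K -> minplus) : Prop := {
  val_surj : forall a, exists x, val x = a;
  val_inf : forall x, val x = None <-> x = 0;
  val_mul : forall x y, val (x * y) = mp_mul (val x) (val y);
  val_add : forall x y, mp_le (mp_add (val x) (val y)) (val (x + y))
}.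

End MinPlus.

Section Tropical.
Variables (Gamma : porderZmodType) (N : nat).

(* The exponents of a tropical polynomial P form the finite set [finsupp P];
   outside of it the coefficient is infinity. *)
Definition tpoly := {fsfun 'rV[int]_N -> option Gamma with None}.

Definition tmonom (P : tpoly) (gamma : 'rV[Gamma]_N) (alpha : 'rV[int]_N) :
    minplus Gamma :=
  mp_mul (P alpha) (Some (\sum_(i < N) gamma ord0 i *~ alpha ord0 i)).

Definition teval (P : tpoly) (gamma : 'rV[Gamma]_N) : minplus Gamma :=
  \big[@mp_add Gamma/None]_(alpha <- finsupp P) tmonom P gamma alpha.

Definition tdominant (P : tpoly) (gamma : 'rV[Gamma]_N) : {fset 'rV[int]_N} :=
  [fset alpha in finsupp P | tmonom P gamma alpha == teval P gamma
                              :> option Gamma].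

Definition hypersurface (P : tpoly) : set 'rV[Gamma]_N :=
  [set gamma | (1 < #|` tdominant P gamma|)%N]%classic.

Definition tropicalization (K : fieldType) (val : K -> minplus Gamma)
    (f : laurent K N) : tpoly :=
  [fsfun alpha in msupp f => val f@_alpha].

End Tropical.

(* Main.v *)
(** Fix [gamma] and a strict total group order on Z^N. Among the terms of a
    non-zero [f], the one of least weight [val f_a + <a, gamma>], ties being
    broken by the order, is unique, and in a product [f * g] the leading terms
    multiply: no other pair of terms can cancel the product of the two leading
    ones. Using an order and its reverse, [gamma] lies on the hypersurface of
    [f] iff the two leading exponents of [f] differ. Since the first never
    exceeds the second, they agree for [f * g] iff they agree for both factors. *)
Require Import Defs.
From HB Require Import structures.
From mathcomp Require Import all_boot all_order all_algebra.
From mathcomp Require Import finmap.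
From mathcomp Require Import mathcomp_extra boolp classical_sets.
From mathcomp.multinomials Require Import monalg.
Set Implicit Arguments.
Unset Strict Implicit.
Unset Printing Implicit Defensive.
Import Order.TTheory GRing.Theory Num.Theory.
Local Open Scope classical_set_scope.
Local Open Scope ring_scope.

(** Stated for a bare relation, since it serves to compare terms by weight with ties broken by a
    cone. *)
Lemma ex_min_seq (T : eqType) (le : rel T) (s : seq T) :
  total le -> transitive le -> s != [::] ->
  exists2 x, x \in s & {in s, forall y, le x y}.
Proof.
move=> le_total le_trans; have le_refl x : le x x by have := le_total x x; rewrite orbb.
elim: s => // x s IHs _; have [->|/IHs[y ys ymin]] := eqVneq s [::].
  by exists x => [|y]; rewrite !inE // => /eqP ->.
have /orP[xy|yx] := le_total x y.
  exists x; first by rewrite mem_head.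
  move=> z; rewrite inE => /predU1P[->//|zs].
  exact: le_trans xy (ymin z zs).
exists y; first by rewrite inE ys orbT.
by move=> z; rewrite inE => /predU1P[->//|/ymin].
Qed.

(** * Order and arithmetic of the min-plus algebra *)

Section MinPlusOrder.
Variables (Gamma : porderZmodType) (HGamma : totally_ordered_group Gamma).
Implicit Types (a b c d : minplus Gamma) (x y z t : Gamma).

Definition mp_lt a b := ~~ mp_le b a.

Lemma mp_le_refl : reflexive (@mp_le Gamma).
Proof. by case=> //= x. Qed.

Lemma mp_le_total : total (@mp_le Gamma).
Proof. by case=> [x|] [y|] //=; exact: tog_total HGamma x y. Qed.

Lemma mp_le_trans : transitive (@mp_le Gamma).
Proof. by case=> [y|] [x|] [z|] //=; exact: le_trans. Qed.

Lemma mp_le_anti a b : mp_le a b -> mp_le b a -> a = b.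
Proof.
case: a b => [x|] [y|] //= xy yx; congr Some.
by apply/le_anti; rewrite xy.
Qed.

Lemma mp_ltW a b : mp_lt a b -> mp_le a b.
Proof. by rewrite /mp_lt; case/orP: (mp_le_total a b) => ->. Qed.

Lemma mp_le_lt_eq a b : mp_le a b -> mp_lt a b \/ a = b.
Proof.
move=> ab; have [ba|ba] := boolP (mp_le b a); last by left.
by right; exact: mp_le_anti.
Qed.

Lemma mp_lt_le_trans a b c : mp_lt a b -> mp_le b c -> mp_lt a c.
Proof. by move=> ab bc; apply: contra ab => ca; exact: mp_le_trans bc ca. Qed.

Lemma mp_addE a b : mp_add a b = if mp_le a b then a else b.
Proof.
case: a b => [x|] [y|] //=.
rewrite /Order.min lt_def.
have [xy|nxy] := boolP (x <= y); last by rewrite andbF.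
by rewrite andbT; case: eqP => [->|].
Qed.

Lemma mp_le_addl a b : mp_le (mp_add a b) a.
Proof.
rewrite mp_addE; case: ifPn => [_|]; first exact: mp_le_refl.
exact: mp_ltW.
Qed.

Lemma mp_le_addr a b : mp_le (mp_add a b) b.
Proof. by rewrite mp_addE; case: ifPn => // _; exact: mp_le_refl. Qed.

Lemma mp_mulC : commutative (@mp_mul Gamma).
Proof. by case=> [x|] [y|] //=; rewrite addrC. Qed.

Lemma mp_mulACA a b c d :
  mp_mul (mp_mul a b) (mp_mul c d) = mp_mul (mp_mul a c) (mp_mul b d).
Proof. by case: a b c d => [x|] [y|] [z|] [t|] //=; rewrite addrACA. Qed.

Lemma mp_le_mul2r c a b : mp_le a b -> mp_le (mp_mul a c) (mp_mul b c).
Proof.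
by case: a b c => [x|] [y|] [z|] //=; exact: tog_leD2r.
Qed.

(** The common factor must be finite: multiplying by infinity identifies all elements. *)
Lemma mp_le_mulr2 z a b :
  mp_le (mp_mul a (Some z)) (mp_mul b (Some z)) -> mp_le a b.
Proof.
case: a b => [x|] [y|] //= /(tog_leD2r HGamma (- z)).
by rewrite !addrK.
Qed.

Lemma mp_lt_mul2r z a b :
  mp_lt a b -> mp_lt (mp_mul a (Some z)) (mp_mul b (Some z)).
Proof. by apply: contra => /mp_le_mulr2. Qed.

Lemma mp_le_mul a b c d :
  mp_le a b -> mp_le c d -> mp_le (mp_mul a c) (mp_mul b d).
Proof.
move=> ab cd; apply: mp_le_trans (mp_le_mul2r c ab) _.
by rewrite !(mp_mulC b) mp_le_mul2r.
Qed.

(** Strictness survives because the factor [Some z] on the smaller side is finite; [d] may be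
    infinite. *)
Lemma mp_lt_le_mul a b z d :
  mp_lt a b -> mp_le (Some z) d -> mp_lt (mp_mul a (Some z)) (mp_mul b d).
Proof.
move=> ab cd; apply: mp_lt_le_trans (mp_lt_mul2r z ab) _.
exact: mp_le_mul (mp_le_refl b) cd.
Qed.

Lemma le_big_mp_add (I : eqType) (s : seq I) (F : I -> minplus Gamma) i :
  i \in s -> mp_le (\big[@mp_add Gamma/None]_(j <- s) F j) (F i).
Proof.
elim: s => // j s IHs; rewrite big_cons inE => /predU1P[->|/IHs].
  exact: mp_le_addl.
exact: mp_le_trans (mp_le_addr _ _).
Qed.

Lemma big_mp_add_min (I : eqType) (s : seq I) (F : I -> minplus Gamma) i :
    i \in s -> {in s, forall j, mp_le (F i) (F j)} ->
  \big[@mp_add Gamma/None]_(j <- s) F j = F i.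
Proof.
move=> si imin; apply: mp_le_anti; first exact: (le_big_mp_add F si).
rewrite big_seq; apply: (big_ind (mp_le (F i))) => [|a b ia ib|j /imin//]; first by case: (F i).
by rewrite mp_addE; case: ifP.
Qed.

(** An ordered group has no 2-torsion: [x = - x] puts [x] on both sides of 0. This yields
    [val (-1) = Some 0]. *)
Lemma tog_double_eq0 x : x + x = 0 -> x = 0.
Proof.
move=> xx; have xN : x = - x by apply/eqP; rewrite -addr_eq0 xx.
by have /orP[x0|x0] := tog_total HGamma x 0; apply/le_anti; rewrite x0 ?andbT /=;
  have := tog_leD2r HGamma (- x) x0; rewrite subrr add0r -xN.
Qed.

End MinPlusOrder.

(** * Weights of terms at the point [gamma] *)

Section WeightedValuation.
Variables (Gamma : porderZmodType) (HGamma : totally_ordered_group Gamma).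
Variables (K : fieldType) (val : K -> minplus Gamma) (Hval : is_valuation val).
Variables (N : nat) (gamma : 'rV[Gamma]_N).
Implicit Types (a b c : 'rV[int]_N) (x y : K) (v : minplus Gamma).

(** For a fixed exponent this is [val] shifted by a constant, so it inherits the ultrametric
    inequality; letting the exponent vary makes it multiplicative on terms. *)
Definition weight a x : minplus Gamma :=
  mp_mul (val x) (Some (\sum_(i < N) gamma ord0 i *~ a ord0 i)).

Lemma val1 : val 1 = Some 0.
Proof.
have := val_mul Hval 1 1; rewrite mulr1.
case E : (val 1) => [z|] /=; last by move/val_inf: E => /(_ Hval)/eqP; rewrite oner_eq0.
by case=> /eqP; rewrite -subr_eq0 opprD addrA subrr sub0r oppr_eq0 => /eqP ->.
Qed.

Lemma valN1 : val (-1) = Some 0.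
Proof.
have := val_mul Hval (-1) (-1); rewrite mulrNN mulr1 val1.
by case: (val _) => [z|] //= [/esym/(tog_double_eq0 HGamma) ->].
Qed.

Lemma valN x : val (- x) = val x.
Proof.
rewrite -mulN1r (val_mul Hval) valN1.
by case: (val x) => //= z; rewrite add0r.
Qed.

Lemma weight_eq0 a x : weight a x = None <-> x = 0.
Proof. by rewrite -(val_inf Hval) /weight; case: (val x). Qed.

Lemma weight_neq0 a x : x != 0 -> exists z, weight a x = Some z.
Proof.
move=> /eqP; rewrite -(weight_eq0 a).
by case: (weight a x) => // z _; exists z.
Qed.

Lemma weight0 a : weight a 0 = None.
Proof. exact/weight_eq0. Qed.

Lemma weightN a x : weight a (- x) = weight a x.
Proof. by rewrite /weight valN. Qed.

Lemma weightM a b x y :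
  weight (a + b) (x * y) = mp_mul (weight a x) (weight b y).
Proof.
rewrite /weight (val_mul Hval) mp_mulACA /= -big_split /=.
by congr (mp_mul _ (Some _)); apply: eq_bigr => i _; rewrite mxE mulrzDr.
Qed.

Lemma weightD a x y :
  mp_le (mp_add (weight a x) (weight a y)) (weight a (x + y)).
Proof.
apply: mp_le_trans (mp_le_mul2r HGamma _ (val_add Hval x y)).
rewrite [mp_add (val _) _]mp_addE; case: ifP => _.
- exact: mp_le_addl.
- exact: mp_le_addr.
Qed.

Lemma weightD_ge a v x y :
  mp_le v (weight a x) -> mp_le v (weight a y) -> mp_le v (weight a (x + y)).
Proof.
move=> vx vy; apply: mp_le_trans (weightD a x y).
by rewrite mp_addE; case: ifP.
Qed.

Lemma weightD_gt a v x y :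
  mp_lt v (weight a x) -> mp_lt v (weight a y) -> mp_lt v (weight a (x + y)).
Proof.
move=> vx vy; apply: mp_lt_le_trans (weightD a x y).
by rewrite mp_addE; case: ifP.
Qed.

Lemma weight_sum_ge a v (I : eqType) (s : seq I) (F : I -> K) :
    {in s, forall i, mp_le v (weight a (F i))} ->
  mp_le v (weight a (\sum_(i <- s) F i)).
Proof.
move=> vF; rewrite big_seq.
apply: (big_ind (fun x => mp_le v (weight a x))) => //; last exact: weightD_ge.
by rewrite weight0; case: v {vF}.
Qed.

(** The bound is finite because an empty sum is 0, whose weight is infinite, and nothing lies
    strictly above infinity. *)
Lemma weight_sum_gt a z (I : eqType) (s : seq I) (P : pred I) (F : I -> K) :
    (forall i, i \in s -> P i -> mp_lt (Some z) (weight a (F i))) ->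
  mp_lt (Some z) (weight a (\sum_(i <- s | P i) F i)).
Proof.
move=> vF; rewrite big_seq_cond.
apply: (big_ind (fun x => mp_lt (Some z) (weight a x))) => [||i /andP[]].
- by rewrite weight0.
- exact: weightD_gt.
- exact: vF.
Qed.

Lemma weightD_eq a x y :
  mp_lt (weight a x) (weight a y) -> weight a (x + y) = weight a x.
Proof.
move=> xy; apply/esym/mp_le_anti.
  by apply: weightD_ge; [exact: mp_le_refl|exact: mp_ltW].
apply/negPn/negP => xxy; have := mp_le_refl (weight a x).
(* Writing [x] as [(x + y) - y], a heavier [x + y] would make [x] strictly heavier than itself. *)
apply/negP; rewrite -/(mp_lt _ _) -{2}(addrK y x).
by apply: weightD_gt => //; rewrite weightN.
Qed.

End WeightedValuation.

(** For each [a] only [b = c - a] contributes; if it lies outside the support of [g], its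
    coefficient is 0 by default. *)
Lemma mcoeff_laurentM (R : comNzRingType) (N : nat) (f g : laurent R N) c :
  (f * g)@_c = \sum_(a <- msupp f) f@_a * g@_(c - a).
Proof.
rewrite [f * g]/(laurent_mul f g) /laurent_mul raddf_sum /=.
apply: eq_bigr => a _; rewrite raddf_sum /=.
transitivity (\sum_(b <- msupp g) (f@_a * g@_b) *+ (b == c - a)).
  by apply: eq_bigr => b _; rewrite mcoeffU addrC eq_sym -subr_eq eq_sym.
have [cg|cg] := boolP (c - a \in msupp g).
  rewrite (bigD1_seq (c - a)) //= ?fset_uniq// eqxx big1 ?addr0//.
  by move=> b /negPf ->.
rewrite (mcoeff_outdom cg) mulr0 big_seq big1// => b bg.
by case: eqP => // bc; rewrite -bc bg in cg.
Qed.

(* The set of positive elements of a total group order on V. *)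
Record strict_cone (V : zmodType) (P : pred V) : Prop := {
  cone0 : ~~ P 0;
  coneD : forall u v, P u -> P v -> P (u + v);
  cone_total : forall u, u != 0 -> P u || P (- u)
}.

(** * Reversal and cancellation in a total group order *)

Section StrictCone.
Variables (V : zmodType) (P : pred V) (HP : strict_cone P).
Implicit Types u v : V.

(** The reverse order is of the same kind, so every result on leading exponents applies to it as
    well. *)
Lemma strict_coneN : strict_cone (fun u => P (- u)).
Proof.
split=> [|u v Pu Pv|u u0]; first by rewrite oppr0 cone0.
- by rewrite opprD coneD.
- by rewrite opprK orbC cone_total.
Qed.

Lemma coneN u : P u -> ~~ P (- u).
Proof. by move=> Pu; apply: contra (cone0 HP) => /(coneD HP Pu); rewrite subrr. Qed.

(** The premise [u != 0 -> P u] encodes non-negativity. As [v = - u], a positive [u] would make [v]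
    negative. *)
Lemma cone_add_eq0 u v :
  (u != 0 -> P u) -> (v != 0 -> P v) -> u + v = 0 -> u = 0 /\ v = 0.
Proof.
move=> Pu Pv /eqP; rewrite addrC addr_eq0 => /eqP vu.
have [u0|/[dup] u0 /Pu pu] := eqVneq u 0; first by rewrite vu u0 oppr0.
by have := Pv; rewrite vu oppr_eq0 (negPf (coneN pu)) => /(_ u0).
Qed.

End StrictCone.

(** Lexicographic positivity: the first non-zero coordinate is positive. *)
Definition lex_pos (N : nat) : pred 'rV[int]_N := fun v =>
  [exists i, (0 < v ord0 i) && [forall j : 'I_N, (j < i)%N ==> (v ord0 j == 0)]].

Lemma strict_cone_lex_pos (N : nat) : strict_cone (@lex_pos N).
Proof.
have posP (v : 'rV[int]_N) i : 0 < v ord0 i ->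
    (forall j : 'I_N, (j < i)%N -> v ord0 j = 0) -> lex_pos v.
  move=> vi v0; apply/existsP; exists i; rewrite vi /=.
  by apply/forallP => j; apply/implyP => /v0 ->.
split=> [|u v /existsP[i /andP[ui /forallP u0]] /existsP[j /andP[vj /forallP v0]]|u u0].
- by apply/existsP => -[i]; rewrite mxE ltxx.
(* The first non-zero coordinate of [u + v] sits at the smaller of [i] and [j]; if they coincide,
   two positive entries add up. *)
- case: (ltngtP i j) => [ij|ji|/val_inj ij].
  + apply: (posP _ i) => [|k ki]; rewrite mxE.
      by have /implyP/(_ ij)/eqP -> := v0 i; rewrite addr0.
    have /implyP/(_ ki)/eqP -> := u0 k.
    by have /implyP/(_ (ltn_trans ki ij))/eqP -> := v0 k.
  + apply: (posP _ j) => [|k kj]; rewrite mxE.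
      by have /implyP/(_ ji)/eqP -> := u0 j; rewrite add0r.
    have /implyP/(_ kj)/eqP -> := v0 k.
    by have /implyP/(_ (ltn_trans kj ji))/eqP -> := u0 k.
  + apply: (posP _ i) => [|k ki]; rewrite mxE.
      by rewrite addr_gt0// ij.
    have /implyP/(_ ki)/eqP -> := u0 k; rewrite ij in ki.
    by have /implyP/(_ ki)/eqP -> := v0 k.
- have [i0 ui0] : exists i, u ord0 i != 0.
    by apply/rV0Pn.
  (* The least index of a non-zero coordinate: its sign decides between [u] and [- u]. *)
  have [i ui imin] :=
    @arg_minnP _ i0 (fun i => u ord0 i != 0) (@nat_of_ord N) ui0.
  have uj0 (j : 'I_N) : (j < i)%N -> u ord0 j = 0.
    by move=> ji; apply/eqP; apply: contraTT ji => /imin; rewrite -leqNgt.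
  have [|ui'|/eqP] := ltgtP (u ord0 i) 0; last by rewrite (negPf ui).
  + move=> ui'; apply/orP; right; apply: (posP _ i) => [|j ji].
      by rewrite mxE oppr_gt0.
    by rewrite mxE uj0 // oppr0.
  + by apply/orP; left; exact: (posP _ i).
Qed.

(** * Leading exponents at [gamma] and the hypersurface *)

Section LeadingExponent.
Variables (Gamma : porderZmodType) (HGamma : totally_ordered_group Gamma).
Variables (K : fieldType) (val : K -> minplus Gamma) (Hval : is_valuation val).
Variables (N : nat) (gamma : 'rV[Gamma]_N).
Implicit Types (P : pred 'rV[int]_N) (a b c : 'rV[int]_N) (f g : laurent K N).

Local Notation wt := (weight val gamma).

(** Here [b] ranges over all of Z^N: outside the support its weight is infinite, hence strictly
    above that of [a]. *)
Definition leading P f a :=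
  f@_a != 0 /\
  forall b, b != a ->
    mp_lt (wt a f@_a) (wt b f@_b) \/ wt a f@_a = wt b f@_b /\ P (b - a).

Lemma leading_le P f a b : leading P f a -> mp_le (wt a f@_a) (wt b f@_b).
Proof.
case=> _ fa; have [->|/fa[|[-> _]]] := eqVneq b a; [|exact: mp_ltW|];
  exact: mp_le_refl.
Qed.

Lemma leading_neq0 P f a : leading P f a -> f != 0.
Proof. by case=> + _; apply: contra_neq => ->; rewrite mcoeff0. Qed.

Lemma leading1 P : leading P (1 : laurent K N) 0.
Proof.
have E a : (1 : laurent K N)@_a = (a == 0)%:R.
  by rewrite [1]/(laurent_one _ _) mcoeffU eq_sym.
split=> [|b b0]; first by rewrite E eqxx oner_eq0.
rewrite !E eqxx (negPf b0) weight0//; left.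
by have [z ->] := weight_neq0 Hval gamma 0 (oner_neq0 K).
Qed.

Lemma leading_exists P f : strict_cone P -> f != 0 -> exists a, leading P f a.
Proof.
move=> HP f0.
(* Weight first, ties broken by the cone; a minimum of this total preorder on the support is the
   leading exponent. *)
pose le a b := mp_le (wt a f@_a) (wt b f@_b) &&
  (mp_le (wt b f@_b) (wt a f@_a) ==> ((b == a) || P (b - a))).
have le_total : total le.
  move=> a b; rewrite /le.
  have [ab|ab] := boolP (mp_le (wt a f@_a) (wt b f@_b)); last first.
    by have := mp_le_total HGamma (wt a f@_a) (wt b f@_b); rewrite (negPf ab) /= => ->.
  have [ba|ba] //= := boolP (mp_le (wt b f@_b) (wt a f@_a)).
  rewrite [a == b]eq_sym; have [//|ab'] := eqVneq b a => /=.
  by rewrite -(opprB b a); apply: cone_total; rewrite // subr_eq0.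
have le_trans : transitive le.
  move=> b a c /andP[ab /implyP ba] /andP[bc /implyP cb].
  rewrite /le (mp_le_trans ab bc) /=; apply/implyP => ca.
  have /orP[/eqP <-|Pba] := ba (mp_le_trans bc ca); first exact: cb (mp_le_trans ca ab).
  have /orP[/eqP ->|Pcb] := cb (mp_le_trans ca ab); first by rewrite Pba orbT.
  have -> : c - a = (c - b) + (b - a) by rewrite addrA subrK.
  by rewrite (coneD HP)// orbT.
have [|a af amin] := @ex_min_seq _ le (msupp f) le_total le_trans.
  apply: contra_neq f0 => s0; apply/malgP => a; rewrite mcoeff0.
  by apply: mcoeff_outdom; rewrite -[a \in _]/(a \in (msupp f : seq _)) s0.
have fa0 : f@_a != 0 by rewrite mcoeff_neq0.
exists a; split=> // b ba.
have [bf|bf] := boolP (b \in msupp f); last first.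
  rewrite (mcoeff_outdom bf) weight0//; left.
  by have [z ->] := weight_neq0 Hval gamma a fa0.
have /andP[ab /implyP] := amin b bf; rewrite (negPf ba) /=.
have [ab' _|ab'] := mp_le_lt_eq ab; first by left.
by rewrite -ab' mp_le_refl => /(_ isT); right.
Qed.

(** Replacing a leading exponent raises the weight, or keeps it and moves up in the order. A strict
    gain survives addition since leading weights are finite; with ties only, the positive
    differences add up. *)
Lemma leading_pair P f g a b c d :
    strict_cone P -> leading P f a -> leading P g b -> (c, d) != (a, b) ->
  mp_lt (mp_mul (wt a f@_a) (wt b g@_b)) (mp_mul (wt c f@_c) (wt d g@_d)) \/
  mp_mul (wt a f@_a) (wt b g@_b) = mp_mul (wt c f@_c) (wt d g@_d) /\
  P (c + d - (a + b)).
Proof.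
move=> HP La Lb cd; have leab := leading_le d Lb; have leac := leading_le c La.
have [z Ez] := weight_neq0 Hval gamma a La.1.
have [t Et] := weight_neq0 Hval gamma b Lb.1.
rewrite opprD addrACA.
have [ca|/La.2[lt_ac|[eq_ac Pca]]] := eqVneq c a.
- have /Lb.2[lt_bd|[eq_bd Pdb]] : d != b.
    by apply: contraNneq cd => ->; rewrite ca.
  + left; rewrite ca Ez -![mp_mul (Some z) _]mp_mulC.
    exact: mp_lt_mul2r.
  + by right; rewrite ca eq_bd subrr add0r.
- by left; rewrite Et; apply: mp_lt_le_mul => //; rewrite -Et.
have [->|/Lb.2[lt_bd|[eq_bd Pdb]]] := eqVneq d b.
- by right; rewrite eq_ac subrr addr0.
- left; rewrite Ez mp_mulC [mp_mul (wt c _) _]mp_mulC.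
  by apply: mp_lt_le_mul => //; rewrite -Ez.
- by right; rewrite eq_ac eq_bd (coneD HP).
Qed.

Lemma leadingM P f g a b : strict_cone P ->
  leading P f a -> leading P g b -> leading P (f * g) (a + b).
Proof.
move=> HP La Lb; have fa0 := La.1; have gb0 := Lb.1.
have ab0 : f@_a * g@_b != 0 by rewrite mulf_neq0.
have wterm c d : wt c (f@_d * g@_(c - d)) = mp_mul (wt d f@_d) (wt (c - d) g@_(c - d)).
  by rewrite -weightM// [d + _]addrC subrK.
have [z Ez] := weight_neq0 Hval gamma (a + b) ab0.
(* The other contributions at exponent [a + b] are strictly heavier than the leading one, as a tie
   would put 0 in the cone. So the leading product cannot be cancelled. *)
have wab : wt (a + b) (f * g)@_(a + b) = wt (a + b) (f@_a * g@_b).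
  rewrite mcoeff_laurentM (bigD1_seq a) ?fset_uniq//= -?mcoeff_neq0//.
  rewrite [a + b - a]addrC addKr; apply: (weightD_eq HGamma Hval).
  rewrite Ez; apply: weight_sum_gt => // d _ da; rewrite wterm -Ez weightM//.
  have [|//|[_]] := @leading_pair _ f g a b d (a + b - d) HP La Lb.
    by apply: contra da => /eqP[->].
  by rewrite [d + _]addrC subrK subrr (negPf (cone0 HP)).
split=> [|c cab]; first by apply/eqP => /(weight_eq0 Hval gamma (a + b)); rewrite wab Ez.
rewrite wab.
have term d : mp_lt (wt (a + b) (f@_a * g@_b)) (wt c (f@_d * g@_(c - d))) \/
    wt (a + b) (f@_a * g@_b) = wt c (f@_d * g@_(c - d)) /\ P (c - (a + b)).
  have := @leading_pair _ f g a b d (c - d) HP La Lb.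
  rewrite wterm weightM// [d + _]addrC subrK; apply.
  by apply: contra cab => /eqP[-> <-]; rewrite addrC subrK.
(* When [c] comes after [a + b] in the order, a weak bound is enough; otherwise no contribution can
   tie, so all are strictly heavier. *)
have [Pc|/negPf Pc] := boolP (P (c - (a + b))).
  suff /(mp_le_lt_eq)[|->] : mp_le (wt (a + b) (f@_a * g@_b)) (wt c (f * g)@_c).
  - by left.
  - by right.
  rewrite mcoeff_laurentM; apply: weight_sum_ge => // d _.
  by have [/(mp_ltW HGamma)//|[-> _]] := term d; exact: mp_le_refl.
left; rewrite mcoeff_laurentM Ez; apply: weight_sum_gt => // d _ _.
by rewrite -Ez; have [//|[_]] := term d; rewrite Pc.
Qed.

Lemma laurent_mulf_neq0 f g : f != 0 -> g != 0 -> f * g != 0.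
Proof.
have HP := strict_cone_lex_pos N.
move=> /(leading_exists HP)[a La] /(leading_exists HP)[b Lb].
exact: leading_neq0 (leadingM HP La Lb).
Qed.

Lemma tropicalizationE f a : tropicalization val f a = val f@_a.
Proof.
rewrite fsfunE; case: ifPn => // /mcoeff_outdom ->.
exact/esym/(val_inf Hval).
Qed.

(** Non-zero coefficients have finite value, so tropicalizing drops no exponent. *)
Lemma finsupp_tropicalization f : finsupp (tropicalization val f) = msupp f.
Proof.
apply/fsetP => a; rewrite mem_finsupp tropicalizationE -mcoeff_neq0.
by congr (~~ _); apply/eqP/eqP; rewrite (val_inf Hval).
Qed.

(** Membership of [b] in the support comes for free: the leading weight is finite, so equality of
    weights forces [f@_b] to be non-zero. *)
Lemma tdominantP P f a b : leading P f a ->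
  b \in tdominant (tropicalization val f) gamma <-> wt b f@_b = wt a f@_a.
Proof.
move=> La; have af : a \in msupp f by rewrite -mcoeff_neq0 La.1.
have tE c : tmonom (tropicalization val f) gamma c = wt c f@_c.
  by rewrite /tmonom tropicalizationE.
have -> : (b \in tdominant (tropicalization val f) gamma) =
    (b \in msupp f) && (wt b f@_b == wt a f@_a).
  rewrite !inE /= finsupp_tropicalization tE; congr (_ && (_ == _)).
  rewrite /teval finsupp_tropicalization (big_mp_add_min HGamma af) ?tE// => c _.
  by rewrite !tE; exact: leading_le La.
split=> [/andP[_ /eqP]//|ba]; rewrite ba eqxx andbT -mcoeff_neq0.
apply/eqP => /(weight_eq0 Hval gamma b); rewrite ba.
by have [z ->] := weight_neq0 Hval gamma a La.1.
Qed.

(** Two different leading exponents are both dominant. If they coincide, another dominant [c] would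
    make both [c - a] and its negative positive. *)
Lemma leading_hypersurface P f a b : strict_cone P ->
    leading P f a -> leading (fun u => P (- u)) f b ->
  hypersurface (tropicalization val f) gamma <-> a != b.
Proof.
move=> HP La Lb; rewrite /hypersurface /=.
have aD := (tdominantP a La).2 erefl; have bD := (tdominantP b Lb).2 erefl.
split=> [|ab]; last first.
  have /fsubset_leq_card :
      ([fset a; b] `<=` tdominant (tropicalization val f) gamma)%fset.
    by apply/fsubsetP => c; rewrite in_fset2 => /orP[] /eqP ->.
  by rewrite cardfs2 ab.
apply: contraTneq => ab; rewrite -leqNgt.
suff /fsubset_leq_card :
    (tdominant (tropicalization val f) gamma `<=` [fset a])%fset.
  by rewrite cardfs1.
apply/fsubsetP => c /(tdominantP c La) ca; rewrite inE; apply/negPn/negP => ca'.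
have [|[_ Pca]] := La.2 c ca'; first by rewrite ca /mp_lt mp_le_refl.
rewrite -ab in Lb.
have [|[_]] := Lb.2 c ca'; first by rewrite ca /mp_lt mp_le_refl.
by rewrite (negPf (coneN HP Pca)).
Qed.

(** Among the exponents of least weight, [P] selects the first and its reverse the last. *)
Lemma leading_reverse P f a b : leading P f a ->
  leading (fun u => P (- u)) f b -> b - a != 0 -> P (b - a).
Proof.
move=> La Lb; rewrite subr_eq0 => /La.2[|[_ //]].
by rewrite /mp_lt (leading_le a Lb).
Qed.

Lemma hypersurfaceM f g : f != 0 -> g != 0 ->
  hypersurface (tropicalization val (f * g)) gamma <->
  hypersurface (tropicalization val f) gamma \/
  hypersurface (tropicalization val g) gamma.
Proof.
have HP := strict_cone_lex_pos N; have HN := strict_coneN HP.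
move=> f0 g0.
have [a La] := leading_exists HP f0; have [a' La'] := leading_exists HN f0.
have [b Lb] := leading_exists HP g0; have [b' Lb'] := leading_exists HN g0.
rewrite (leading_hypersurface HP La La') (leading_hypersurface HP Lb Lb').
rewrite (leading_hypersurface HP (leadingM HP La Lb) (leadingM HN La' Lb')).
split=> [|ab].
  by have [->|] := eqVneq a a'; have [->|] := eqVneq b b'; rewrite ?eqxx; auto.
(* Equal leading exponents of [f * g] would mean [(a' - a) + (b' - b) = 0], where both summands are
   non-negative. *)
apply/eqP => /eqP; rewrite eq_sym -subr_eq0 opprD addrACA => /eqP.
case/(cone_add_eq0 HP (leading_reverse La La') (leading_reverse Lb Lb')).
by move=> /eqP + /eqP; rewrite !subr_eq0 ![_ == a]eq_sym ![_ == b]eq_sym; case: ab => /negPf ->.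
Qed.

Lemma hypersurface_prod (I : eqType) (s : seq I) (f : I -> laurent K N) :
    (forall i, f i != 0) ->
  hypersurface (tropicalization val (\prod_(i <- s) f i)) gamma <->
  exists2 i, i \in s & hypersurface (tropicalization val (f i)) gamma.
Proof.
move=> f0; elim: s => [|i s IHs].
  (* For the empty product both leading exponents are 0, so its hypersurface is empty, like the
     union over no factors. *)
  have HP := strict_cone_lex_pos N.
  rewrite big_nil (leading_hypersurface HP (leading1 _) (leading1 _)) eqxx.
  by split=> // -[].
rewrite big_cons hypersurfaceM// ?IHs.
  split=> [[Hi|[j js Hj]]|[j]].
  - by exists i; rewrite ?mem_head.
  - by exists j; rewrite // inE js orbT.
  - by rewrite inE => /predU1P[->|js Hj]; [left|right; exists j].
(* The two-factor case requires the product of the remaining factors to be non-zero. *)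
by apply: (big_ind (fun h => h != 0)) => //; [exact: oner_neq0|exact: laurent_mulf_neq0].
Qed.

End LeadingExponent.

Theorem proposition5p2 (Gamma : porderZmodType)
    (HGamma : totally_ordered_group Gamma) (K : fieldType)
    (val : K -> minplus Gamma) (Hval : is_valuation val)
    (N : nat) (HN : (1 <= N)%N) :
  (forall f g : laurent K N, f != 0 -> g != 0 ->
    hypersurface (tropicalization val (f * g)) =
    hypersurface (tropicalization val f) `|`
    hypersurface (tropicalization val g))
  /\
  (forall (k : nat) (f : 'I_k -> laurent K N), (1 <= k)%N ->
    (forall i, f i != 0) ->
    hypersurface (tropicalization val (\prod_(i < k) f i)) =
    \bigcup_(i in [set: 'I_k]) hypersurface (tropicalization val (f i))).
Proof.
split=> [f g f0 g0|k f _ f0]; apply/funext => gamma; apply/propext.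
  exact: (hypersurfaceM HGamma Hval gamma f0 g0).
rewrite (hypersurface_prod HGamma Hval gamma _ f0).
split=> [[i _ Hi]|[i _ Hi]]; exists i => //.
by rewrite mem_index_enum.
Qed.
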